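(* Let $\mathbb F$ be a field of characteristic $0$, let $\mathcal A$ be a simple Artinian $\mathbb F$-algebra with center $\mathbb F$, and let $\underline x=\{x_1,\dots,x_g\}$ be a finite alphabet. Every recognizable series $S\in\mathcal A\langle\!\langle\underline x\rangle\!\rangle$ has a reduced representation.
   Context: $\langle\underline x\rangle$ is the free monoid of words in the freely noncommuting letters $x_1,\dots,x_g$, with empty word $1$ and length $|w|$. $\mathcal A\langle\underline x\rangle=\mathcal A*_{\mathbb F}\mathbb F\langle\underline x\rangle$ (free product of unital $\mathbb F$-algebras) is the algebra of generalized polynomials, and $\mathcal A\langle\!\langle\underline x\rangle\!\rangle$ is its $(\underline x)$-adic completion. For $w=w_1\cdots w_\ell$, $\mathcal A^w\subset\mathcal A\langle\underline x\rangle$ is the $\mathbb F$-span of all $a_0w_1a_1\cdots w_\ell a_\ell$, $a_i\in\mathcal A$. Every series is uniquely $S=\sum_w[S,w]$ with $[S,w]\in\mathcal A^w$. A (linear) representation of dimension $n$ of $S$ is a triple $(\mathbf c,A,\mathbf b)$ with $\mathbf c\in\mathcal A^{1\times n}$, $\mathbf b\in\mathcal A^{n\times1}$ and $A^x\in(\mathcal A^x)^{n\times n}$ for $x\in\underline x$ such that $[S,w]=\mathbf cA^w\mathbf b$ for all words $w$, where $A^w=A^{w_1}\cdots A^{w_{|w|}}$. By convention the zero series (and only it) has a representation of dimension $0$. $S$ is recognizable if it has a representation. The left and right obstruction modules of $(\mathbf c,A,\mathbf b)$ are the left, respectively right, $\mathcal A$-modules $$\mathcal U_\infty^L=\{\mathbf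 u\in\mathcal A^{1\times n}:\mathbf uA^w\mathbf b=0\ \forall w\},\qquad \mathcal U_\infty^R=\{\mathbf v\in\mathcal A^{n\times1}:\mathbf cA^w\mathbf v=0\ \forall w\}.$$ A left (right) $\mathcal A$-module $\mathcal M$ is torsion if for every $\mathbf v\in\mathcal M$ there is $a\in\mathcal A\setminus\{0\}$ with $a\mathbf v=0$ (resp. $\mathbf va=0$). A representation is reduced if both its obstruction modules are torsion. *)

(* Defs.v *)
From HB Require Import structures.
From mathcomp Require Import all_boot all_algebra.
From mathcomp Require Import all_classical.

Set Implicit Arguments.
Unset Strict Implicit.
Unset Printing Implicit Defensive.
Set Warnings "-redundant-canonical-projection".

Import GRing.Theory.
Local Open Scope ring_scope.
Local Open Scope quotient_scope.
Local Open Scope classical_set_scope.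

Section RingNotions.
Variables (F : fieldType) (A : algType F).

Definition left_ideal (I : set A) : Prop :=
  [/\ I 0, forall a b, I a -> I b -> I (a + b) & forall r a, I a -> I (r * a)].

Definition right_ideal (I : set A) : Prop :=
  [/\ I 0, forall a b, I a -> I b -> I (a + b) & forall r a, I a -> I (a * r)].

(* An [algType] is a nonzero ring, so [A != 0] need not be repeated. *)
Definition simple_ring : Prop :=
  forall I : set A, left_ideal I -> right_ideal I -> I = [set 0] \/ I = setT.

Definition dcc (C : set A -> Prop) : Prop :=
  forall I : nat -> set A, (forall n, C (I n)) ->
    (forall n, I n.+1 `<=` I n) ->
    exists N : nat, forall n : nat, (N <= n)%N -> I n = I N.

Definition artinian_ring : Prop := dcc left_ideal /\ dcc right_ideal.

(* The center of [A] is the image of [F]; the other inclusion always holds. *)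
Definition center_is_base : Prop :=
  forall z : A, (forall a : A, z * a = a * z) -> exists k : F, z = k%:A.

End RingNotions.

(* The free product [A *_F F<x_1, ..., x_g>] of unital F-algebras: formal
   expressions in elements of [A] and letters, modulo the least congruence that
   makes them a unital ring, makes [gtC] a ring morphism and makes the scalars
   [k%:A] central.  Its universal property is [gpoly_univ] and
   [gpoly_univ_unique] below. *)
Section FreeProduct.
Variables (F : fieldType) (A : algType F) (g : nat).

Inductive gterm : Type :=
  | gtC of A
  | gtX of 'I_g
  | gtadd of gterm & gterm
  | gtmul of gterm & gterm.

HB.instance Definition _ := gen_eqMixin gterm.
HB.instance Definition _ := gen_choiceMixin gterm.

Inductive gcong : gterm -> gterm -> Prop :=
  | gc_refl s : gcong s s
  | gc_sym s t : gcong s t -> gcong t s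
  | gc_trans s t u : gcong s t -> gcong t u -> gcong s u
  | gc_add s s' t t' : gcong s s' -> gcong t t' ->
      gcong (gtadd s t) (gtadd s' t')
  | gc_mul s s' t t' : gcong s s' -> gcong t t' ->
      gcong (gtmul s t) (gtmul s' t')
  | gc_addA s t u : gcong (gtadd s (gtadd t u)) (gtadd (gtadd s t) u)
  | gc_addC s t : gcong (gtadd s t) (gtadd t s)
  | gc_add0 s : gcong (gtadd (gtC 0) s) s
  | gc_addN s : gcong (gtadd (gtmul (gtC (- 1)) s) s) (gtC 0)
  | gc_mulA s t u : gcong (gtmul s (gtmul t u)) (gtmul (gtmul s t) u)
  | gc_mul1l s : gcong (gtmul (gtC 1) s) s
  | gc_mul1r s : gcong (gtmul s (gtC 1)) s
  | gc_mulDl s t u :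
      gcong (gtmul (gtadd s t) u) (gtadd (gtmul s u) (gtmul t u))
  | gc_mulDr s t u :
      gcong (gtmul s (gtadd t u)) (gtadd (gtmul s t) (gtmul s u))
  | gc_CD a b : gcong (gtC (a + b)) (gtadd (gtC a) (gtC b))
  | gc_CM a b : gcong (gtC (a * b)) (gtmul (gtC a) (gtC b))
  | gc_scal (k : F) s : gcong (gtmul (gtC k%:A) s) (gtmul s (gtC k%:A)).

Definition gcongb (s t : gterm) : bool := `[< gcong s t >].

Lemma gcongb_refl : reflexive gcongb.
Proof. by move=> s; apply/asboolP; exact: gc_refl. Qed.

Lemma gcongb_sym : symmetric gcongb.
Proof.
by move=> s t; apply/idP/idP => /asboolP st; apply/asboolP; exact: gc_sym.
Qed.

Lemma gcongb_trans : transitive gcongb.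
Proof.
by move=> t s u /asboolP st /asboolP tu; apply/asboolP; exact: gc_trans tu.
Qed.

Canonical gcong_equiv := EquivRel gcongb gcongb_refl gcongb_sym gcongb_trans.

Definition gpoly : Type := {eq_quot gcong_equiv}.
HB.instance Definition _ := Choice.on gpoly.

Definition gpi (s : gterm) : gpoly := \pi_({eq_quot gcong_equiv}) s.
Definition grepr (p : gpoly) : gterm :=
  repr (p : {eq_quot gcong_equiv}).

Lemma gpiP s t : gpi s = gpi t <-> gcong s t.
Proof.
split; first by move=> /eqP; rewrite eqmodE => /asboolP.
by move=> st; apply/eqP; rewrite eqmodE; apply/asboolP.
Qed.

Lemma greprK p : gpi (grepr p) = p.
Proof. exact: reprK. Qed.

Lemma grepr_pi s : gcong (grepr (gpi s)) s.
Proof. by apply/gpiP; rewrite greprK. Qed.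

Definition gpadd (p q : gpoly) : gpoly := gpi (gtadd (grepr p) (grepr q)).
Definition gpmul (p q : gpoly) : gpoly := gpi (gtmul (grepr p) (grepr q)).
Definition gpopp (p : gpoly) : gpoly := gpmul (gpi (gtC (- 1))) p.
Definition gpscale (k : F) (p : gpoly) : gpoly := gpmul (gpi (gtC k%:A)) p.

Lemma gpaddE s t : gpadd (gpi s) (gpi t) = gpi (gtadd s t).
Proof. by apply/gpiP; apply: gc_add; exact: grepr_pi. Qed.

Lemma gpmulE s t : gpmul (gpi s) (gpi t) = gpi (gtmul s t).
Proof. by apply/gpiP; apply: gc_mul; exact: grepr_pi. Qed.

Lemma gpoly_ind (P : gpoly -> Prop) : (forall s, P (gpi s)) -> forall p, P p.
Proof. by move=> Ps p; rewrite -[p]greprK. Qed.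

Lemma gpaddA : associative gpadd.
Proof.
elim/gpoly_ind=> s; elim/gpoly_ind=> t; elim/gpoly_ind=> u.
by rewrite !gpaddE; apply/gpiP; exact: gc_addA.
Qed.

Lemma gpaddC : commutative gpadd.
Proof.
elim/gpoly_ind=> s; elim/gpoly_ind=> t.
by rewrite !gpaddE; apply/gpiP; exact: gc_addC.
Qed.

Lemma gpadd0 : left_id (gpi (gtC 0)) gpadd.
Proof. by elim/gpoly_ind=> s; rewrite !gpaddE; apply/gpiP; exact: gc_add0. Qed.

Lemma gpaddN : left_inverse (gpi (gtC 0)) gpopp gpadd.
Proof.
elim/gpoly_ind=> s; rewrite /gpopp gpmulE gpaddE.
by apply/gpiP; exact: gc_addN.
Qed.

HB.instance Definition _ := GRing.isZmodule.Build gpoly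
  gpaddA gpaddC gpadd0 gpaddN.

Lemma gpmulA : associative gpmul.
Proof.
elim/gpoly_ind=> s; elim/gpoly_ind=> t; elim/gpoly_ind=> u.
by rewrite !gpmulE; apply/gpiP; exact: gc_mulA.
Qed.

Lemma gpmul1l : left_id (gpi (gtC 1)) gpmul.
Proof. by elim/gpoly_ind=> s; rewrite !gpmulE; apply/gpiP; exact: gc_mul1l. Qed.

Lemma gpmul1r : right_id (gpi (gtC 1)) gpmul.
Proof. by elim/gpoly_ind=> s; rewrite !gpmulE; apply/gpiP; exact: gc_mul1r. Qed.

Lemma gpmulDl : left_distributive gpmul gpadd.
Proof.
elim/gpoly_ind=> s; elim/gpoly_ind=> t; elim/gpoly_ind=> u.
by rewrite !(gpaddE, gpmulE); apply/gpiP; exact: gc_mulDl.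
Qed.

Lemma gpmulDr : right_distributive gpmul gpadd.
Proof.
elim/gpoly_ind=> s; elim/gpoly_ind=> t; elim/gpoly_ind=> u.
by rewrite !(gpaddE, gpmulE); apply/gpiP; exact: gc_mulDr.
Qed.

Section Eval.
Variables (B : algType F) (f : {lrmorphism A -> B}) (y : 'I_g -> B).

Fixpoint gteval (s : gterm) : B :=
  match s with
  | gtC a => f a
  | gtX i => y i
  | gtadd s t => gteval s + gteval t
  | gtmul s t => gteval s * gteval t
  end.

Lemma gteval_cong s t : gcong s t -> gteval s = gteval t.
Proof.
elim=> //=.
- by move=> ? ? ? _ -> _ ->.
- by move=> ? ? ? ? _ -> _ ->.
- by move=> ? ? ? ? _ -> _ ->.
- by move=> *; rewrite addrA.
- by move=> *; rewrite addrC.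
- by move=> *; rewrite rmorph0 add0r.
- by move=> *; rewrite rmorphN1 mulN1r addNr rmorph0.
- by move=> *; rewrite mulrA.
- by move=> *; rewrite rmorph1 mul1r.
- by move=> *; rewrite rmorph1 mulr1.
- by move=> *; rewrite mulrDl.
- by move=> *; rewrite mulrDr.
- by move=> *; rewrite rmorphD.
- by move=> *; rewrite rmorphM.
- by move=> k u; rewrite linearZ /= rmorph1 -scalerAl -scalerAr mul1r mulr1.
Qed.

Definition gpeval (p : gpoly) : B := gteval (grepr p).

Lemma gpeval_pi s : gpeval (gpi s) = gteval s.
Proof. exact/gteval_cong/grepr_pi. Qed.

End Eval.

Lemma gpone_neq0 : gpi (gtC 1) != gpi (gtC 0).
Proof.
apply/eqP => /(congr1 (gpeval (idfun : {lrmorphism A -> A}) (fun=> 0))).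
by rewrite !gpeval_pi /= => /eqP; rewrite oner_eq0.
Qed.

HB.instance Definition _ := GRing.Zmodule_isNzRing.Build gpoly
  gpmulA gpmul1l gpmul1r gpmulDl gpmulDr gpone_neq0.

Lemma gpscaleA a b p : gpscale a (gpscale b p) = gpscale (a * b) p.
Proof.
rewrite /gpscale gpmulA gpmulE; congr gpmul; apply/gpiP.
have -> : (a * b)%:A = a%:A * b%:A :> A by rewrite -scalerAl mul1r scalerA.
exact/gc_sym/gc_CM.
Qed.

Lemma gpscale1 : left_id 1 gpscale.
Proof. by move=> p; rewrite /gpscale scale1r gpmul1l. Qed.

Lemma gpscaleDr : right_distributive gpscale +%R.
Proof. by move=> k p q; exact: gpmulDr. Qed.

Lemma gpscaleDl p : {morph gpscale^~ p : a b / a + b}.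
Proof.
move=> a b; rewrite /gpscale scalerDl.
have -> : gpi (gtC (a%:A + b%:A)) = gpadd (gpi (gtC a%:A)) (gpi (gtC b%:A)).
  by rewrite gpaddE; apply/gpiP; exact: gc_CD.
exact: gpmulDl.
Qed.

HB.instance Definition _ := GRing.Zmodule_isLmodule.Build F gpoly
  gpscaleA gpscale1 gpscaleDr gpscaleDl.

Lemma gpscaleAl (k : F) (p q : gpoly) : k *: (p * q) = (k *: p) * q.
Proof. exact: gpmulA. Qed.

HB.instance Definition _ := GRing.Lmodule_isLalgebra.Build F gpoly gpscaleAl.

Lemma gpscaleAr (k : F) (p q : gpoly) : k *: (p * q) = p * (k *: q).
Proof.
have comm_k : gpmul (gpi (gtC k%:A)) p = gpmul p (gpi (gtC k%:A)).
  by elim/gpoly_ind: p => s; rewrite !gpmulE; apply/gpiP; exact: gc_scal.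
rewrite -[k *: (p * q)]/(gpmul _ (gpmul p q)) gpmulA comm_k.
exact/esym/gpmulA.
Qed.

HB.instance Definition _ := GRing.Lalgebra_isAlgebra.Build F gpoly gpscaleAr.

Definition gconst (a : A) : gpoly := gpi (gtC a).
Definition gvar (i : 'I_g) : gpoly := gpi (gtX i).

Lemma gconstB : zmod_morphism gconst.
Proof.
have gconstD a b : gconst (a + b) = gconst a + gconst b.
  by rewrite -[RHS]/(gpadd _ _) gpaddE; apply/gpiP; exact: gc_CD.
by move=> a b; apply/eqP; rewrite eq_sym subr_eq -gconstD subrK.
Qed.

Lemma gconstM : monoid_morphism gconst.
Proof.
by split=> // a b; rewrite -[RHS]/(gpmul _ _) gpmulE; apply/gpiP; exact: gc_CM.
Qed.

HB.instance Definition _ := GRing.isZmodMorphism.Build A gpoly gconst gconstB.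
HB.instance Definition _ := GRing.isMonoidMorphism.Build A gpoly gconst gconstM.

Lemma gconstZ : scalable gconst.
Proof. by move=> k a; rewrite -mulr_algl rmorphM. Qed.

HB.instance Definition _ :=
  GRing.isScalable.Build F A gpoly *:%R gconst gconstZ.

Section Universal.
Variables (B : algType F) (f : {lrmorphism A -> B}) (y : 'I_g -> B).
Local Notation ev := (gpeval f y).

Lemma gpeval_add : {morph ev : p q / p + q}.
Proof.
elim/gpoly_ind=> s; elim/gpoly_ind=> t.
by rewrite -[_ + _]/(gpadd _ _) gpaddE !gpeval_pi.
Qed.

Lemma gpeval_mul : {morph ev : p q / p * q}.
Proof.
elim/gpoly_ind=> s; elim/gpoly_ind=> t.
by rewrite -[_ * _]/(gpmul _ _) gpmulE !gpeval_pi.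
Qed.

Lemma gpeval_zmod : zmod_morphism ev.
Proof.
by move=> p q; apply/eqP; rewrite eq_sym subr_eq -gpeval_add subrK.
Qed.

Lemma gpeval_monoid : monoid_morphism ev.
Proof. by split; [rewrite gpeval_pi /= rmorph1|exact: gpeval_mul]. Qed.

Lemma gpeval_scal : scalable ev.
Proof.
move=> k p; rewrite -[k *: p]/(gpi (gtC k%:A) * p : gpoly) gpeval_mul.
by rewrite gpeval_pi /= linearZ /= rmorph1 -scalerAl mul1r.
Qed.

HB.instance Definition _ := GRing.isZmodMorphism.Build gpoly B ev gpeval_zmod.
HB.instance Definition _ :=
  GRing.isMonoidMorphism.Build gpoly B ev gpeval_monoid.
HB.instance Definition _ :=
  GRing.isScalable.Build F gpoly B *:%R ev gpeval_scal.

Lemma gpoly_univ : exists h : {lrmorphism gpoly -> B},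
  (forall a, h (gconst a) = f a) /\ (forall i, h (gvar i) = y i).
Proof. by exists ev; split=> [a|i] /=; rewrite gpeval_pi. Qed.

Lemma gpoly_univ_unique (h h' : {lrmorphism gpoly -> B}) :
  (forall a, h (gconst a) = h' (gconst a)) ->
  (forall i, h (gvar i) = h' (gvar i)) -> h =1 h'.
Proof.
move=> hC hX; elim/gpoly_ind; elim=> [a|i|s IHs t IHt|s IHs t IHt].
- exact: hC.
- exact: hX.
- by rewrite -gpaddE -[gpadd _ _]/(gpi s + gpi t) !rmorphD /= IHs IHt.
- by rewrite -gpmulE -[gpmul _ _]/(gpi s * gpi t) !rmorphM /= IHs IHt.
Qed.

End Universal.

End FreeProduct.

Section Representations.
Variables (F : fieldType) (A : algType F) (g : nat).
Local Notation word := (seq 'I_g).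
Local Notation poly := (gpoly A g).

(* [a_0 w_1 a_1 ... w_l a_l]; only the values [a 0, ..., a l] matter. *)
Definition gmonomial (w : word) (a : nat -> A) : poly :=
  gconst g (a 0%N) *
  \prod_(i < size w) (gvar A (tnth (in_tuple w) i) * gconst g (a i.+1)).

Definition homog (w : word) : set poly :=
  [set p | exists m (k : 'I_m -> F) (a : 'I_m -> nat -> A),
     p = \sum_(j < m) k j *: gmonomial w (a j)].

(* The (x)-adic completion of [gpoly A g] is the product of the [homog w]: a
   series [S] is given by its components [[S, w]]. *)
Record gseries := GSeries {
  gcoef :> word -> poly;
  gcoefP : forall w, homog w (gcoef w)
}.

Record representation (n : nat) := Representation {
  rep_c : 'rV[A]_n;
  rep_A : 'I_g -> 'M[poly]_n;
  rep_b : 'cV[A]_n;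
  rep_AP : forall x i j, homog [:: x] (rep_A x i j)
}.

Section Fixed.
Variables (n : nat) (r : representation n).

Definition rep_word (w : word) : 'M[poly]_n :=
  \big[mulmx/1%:M]_(x <- w) rep_A r x.

Definition row_const (u : 'rV[A]_n) : 'rV[poly]_n := map_mx (@gconst F A g) u.
Definition col_const (v : 'cV[A]_n) : 'cV[poly]_n := map_mx (@gconst F A g) v.

(* For [n = 0] the right-hand side is an empty sum, so exactly the zero series
   has a representation of dimension 0. *)
Definition represents (S : gseries) : Prop :=
  forall w, (S w)%:M =
    row_const (rep_c r) *m rep_word w *m col_const (rep_b r) :> 'M_1.

Definition left_obstruction : set 'rV[A]_n :=
  [set u | forall w, row_const u *m rep_word w *m col_const (rep_b r) = 0].

Definition right_obstruction : set 'cV[A]_n :=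
  [set v | forall w, row_const (rep_c r) *m rep_word w *m col_const v = 0].

Definition left_torsion (M : set 'rV[A]_n) : Prop :=
  forall u, M u -> exists2 a : A, a != 0 & a *: u = 0.

(* [v *m a%:M] is the right scalar multiple [v a], [A] being noncommutative. *)
Definition right_torsion (M : set 'cV[A]_n) : Prop :=
  forall v, M v -> exists2 a : A, a != 0 & v *m a%:M = 0.

Definition reduced : Prop :=
  left_torsion left_obstruction /\ right_torsion right_obstruction.

End Fixed.

Definition recognizable (S : gseries) : Prop :=
  exists n (r : representation n), represents r S.

End Representations.

(* Main.v *)
Require Import Defs.
From HB Require Import structures.
From mathcomp Require Import all_boot all_algebra.
From mathcomp Require Import all_classical.
Import GRing.Theory.
Local Open Scope ring_scope.

(** Every representation of [S] of least dimension is reduced.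
    Suppose that the left obstruction module of [(c, A, b)], of dimension
    [n + 1], contains a vector [u] with zero left annihilator.  Over a simple
    Artinian ring the module generated by [u] is then a free direct summand of
    rank one whose complement is free of rank [n], that is,
    [1 = P Q + v u] with [P] of size [(n + 1) x n] and [Q] of size
    [n x (n + 1)] ([unimodular_row_compl]).  As [u] kills every [A^w b], the
    product [P Q] fixes every [A^w b], and so the triple
    [(c P, Q A^x P, Q b)], of dimension [n], represents the same series
    ([represents_compress_left]).  The right obstruction module is treated in
    the same way, with [1 = P Q + v u] for a column [v] that every [c A^w]
    kills ([unimodular_col_compl], [represents_compress_right]).

    The splitting of [1] comes from the stable range condition
    ([stable_range]): if no nonzero [y] kills [a] and all the [b_i] from the
    left, then [a + \sum_i b_i t_i] is invertible for suitable [t_i].  Choose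
    the [t_i] so that the left annihilator of [a' := a + \sum_i b_i t_i] is
    minimal.  If it is nonzero, then [a'] is not invertible, and [a' e = 0] for
    some idempotent [e != 0].  Take [y != 0] killing [a']; then [y b_i != 0]
    for some [i], and [y b_i s e != 0] for some [s] because the ring is prime.
    The elements that kill [a' + b_i s e] from the left kill
    [(a' + b_i s e) (1 - e) = a'], but [y] is not one of them: this contradicts
    minimality.  Everything on the other side follows by passing to the
    converse ring. *)

(** * Artinian prime rings *)

(** The right-handed notions are those of the converse ring [R^c]; the Artinian
    condition is stated as the existence of minimal left ideals with a given
    property, the form in which it is used. *)
Definition lideal (R : nzRingType) (I : set R) : Prop :=
  [/\ I 0, forall a b, I a -> I b -> I (a + b) & forall r a, I a -> I (r * a)].

Definition left_artinian (R : nzRingType) : Prop :=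
  forall P : set R -> Prop, (exists I, lideal R I /\ P I) ->
  exists I, [/\ lideal R I, P I &
    forall J, lideal R J -> P J -> (J `<=` I)%classic -> (I `<=` J)%classic].

Definition prime_ring (R : nzRingType) : Prop :=
  forall x y : R, x != 0 -> y != 0 -> exists s, x * s * y != 0.

Lemma dcc_minimal (T : Type) (C P : set T -> Prop) :
  (forall I : nat -> set T, (forall n, C (I n)) ->
    (forall n, (I n.+1 `<=` I n)%classic) ->
    exists N : nat, forall n : nat, (N <= n)%N -> I n = I N) ->
  (exists I, C I /\ P I) ->
  exists I, [/\ C I, P I &
    forall J, C J -> P J -> (J `<=` I)%classic -> (I `<=` J)%classic].
Proof.
move=> dccC [I0 [CI0 PI0]]; apply: contrapT => nomin.
pose D := {I | C I /\ P I}.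
have smaller (I : D) : exists J : D,
    (sval J `<=` sval I)%classic /\ ~ (sval I `<=` sval J)%classic.
  case: I => I [CI PI] /=; apply: contrapT => noJ; apply: nomin.
  exists I; split=> // J CJ PJ JI; apply: contrapT => nIJ.
  by apply: noJ; exists (exist _ J (conj CJ PJ)).
have [f fP] := choice smaller.
pose d n := iter n f (exist _ I0 (conj CI0 PI0)).
have [||N dN] := dccC (fun n => sval (d n)).
- by move=> n; case: (svalP (d n)).
- by move=> n; case: (fP (d n)).
by have := (fP (d N)).2; rewrite -[f _]/(d N.+1) dN // => /(_ (fun _ => id)).
Qed.

(** The chain of left ideals [R x^k] is stationary, so [x^k = y x^(k+1)]
    for some [k]; cancelling [x^k] gives [y x = 1], and then [x y = 1] follows by
    cancelling [x] in [x y x = x]. *)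
Lemma left_regular_unit (R : nzRingType) (x : R) : left_artinian R ->
  (forall y, y * x = 0 -> y = 0) -> exists z, z * x = 1 /\ x * z = 1.
Proof.
move=> artR regx.
pose pow_ideal k : set R := fun z => exists y, z = y * x ^+ k.
have pow_idealP k : lideal R (pow_ideal k).
  split=> [|_ _ [y ->] [z ->]|r _ [y ->]].
  - by exists 0; rewrite mul0r.
  - by exists (y + z); rewrite mulrDl.
  - by exists (r * y); rewrite mulrA.
have regX k y : y * x ^+ k = 0 -> y = 0.
  elim: k => [|k IHk]; first by rewrite mulr1.
  by rewrite exprSr mulrA => /regx /IHk.
have [|_ [_ [k ->] kmin]] := artR (fun I => exists k, I = pow_ideal k).
  by exists (pow_ideal 0%N); split=> //; exists 0%N.
have [||||y xk] := kmin (pow_ideal k.+1) _ _ _ (x ^+ k) _.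
- exact: pow_idealP.
- by exists k.+1.
- by move=> _ [y ->]; exists (y * x); rewrite exprS mulrA.
- by exists 1; rewrite mul1r.
have yx1 : y * x = 1.
  apply/esym/eqP; rewrite -subr_eq0; apply/eqP/(regX k).
  by rewrite mulrBl mul1r -mulrA -exprS -xk subrr.
exists y; split=> //; apply/eqP; rewrite -subr_eq0; apply/eqP/regx.
by rewrite mulrBl -mulrA yx1 mulr1 mul1r subrr.
Qed.

(** Brauer's lemma: a minimal left ideal [I] has an element [x] with
    [I x = I], so that [x = e x] for some [e] in [I], and right multiplication
    by [x] is injective on [I]. *)
Lemma lideal_idempotent (R : nzRingType) (I : set R) (y : R) :
  prime_ring R -> left_artinian R -> lideal R I -> I y -> y != 0 ->
  exists e, [/\ I e, e != 0 & e * e = e].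
Proof.
move=> primeR artR lI Iy y0.
pose nz (J : set R) := (J `<=` I)%classic /\ exists2 z, J z & z != 0.
have [|J [[J0 JD JM] [JI [z Jz z0]] Jmin]] := artR nz.
  by exists I; do !split=> //; exists y.
have [s zsz] := primeR _ _ z0 z0.
have Jx : J (s * z) by exact: JM.
move: zsz; rewrite -mulrA; move: (s * z) Jx => x Jx zx.
have [|||e Je xe] := Jmin (fun v => exists2 u, J u & v = u * x) _ _ _ x Jx.
- split=> [|_ _ [u Ju ->] [v Jv ->]|r _ [u Ju ->]].
  + by exists 0; rewrite ?mul0r.
  + by exists (u + v); rewrite ?mulrDl //; exact: JD.
  + by exists (r * u); rewrite ?mulrA //; exact: JM.
- split; first by move=> _ [u Ju ->]; apply/JI/JM.
  by exists (z * x) => //; exists z.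
- by move=> _ [u Ju ->]; exact: JM.
have injx v : J v -> v * x = 0 -> v = 0.
  move=> Jv vx; apply/eqP; apply: contrapT => /negP v0; move/eqP: zx; apply.
  have [|||] := Jmin (fun w => J w /\ w * x = 0) _ _ _ z Jz => //.
  - split=> [|a b [Ja ax] [Jb bx]|r a [Ja ax]]; first by rewrite mul0r.
    + by split; [exact: JD | rewrite mulrDl ax bx addr0].
    + by split; [exact: JM | rewrite -mulrA ax mulr0].
  - by split; [move=> w [/JI] | exists v].
  - by move=> w [].
exists e; split; first exact: JI.
  by apply: contraNneq zx => e0; rewrite xe e0 mul0r mulr0.
apply/eqP; rewrite -subr_eq0; apply/eqP/injx.
  by rewrite -[X in _ - X]mul1r -mulrBl; exact: JM.
by rewrite mulrBl -mulrA -!xe subrr.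
Qed.

Lemma prime_ring_converse (R : nzRingType) : prime_ring R -> prime_ring R^c.
Proof.
move=> primeR x y x0 y0; have [s ysx] := primeR _ _ y0 x0.
by exists s; rewrite -[x * s * y]/((y : R) * ((s : R) * (x : R))) mulrA.
Qed.

(** For [x != 0], the elements [z] with [x s z = 0] for all [s] form a two-sided
    ideal that does not contain [1]. *)
Lemma simple_ring_prime (F : fieldType) (A : algType F) :
  simple_ring A -> prime_ring A.
Proof.
move=> simpleA x y x0 y0; apply: contrapT => nos.
have xsy s : x * s * y = 0.
  by apply/eqP; apply: contrapT => /negP xsy; apply: nos; exists s.
pose K : set A := fun z => forall s, x * s * z = 0.
have [||K0|KT] := simpleA K.
- split=> [s|z w xz xw s|r z xz s]; first by rewrite mulr0.
  + by rewrite mulrDr xz xw addr0.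
  + by rewrite mulrA -(mulrA x) xz.
- split=> [s|z w xz xw s|r z xz s]; first by rewrite mulr0.
  + by rewrite mulrDr xz xw addr0.
  + by rewrite mulrA xz mul0r.
- suff /eqP : y = 0 by rewrite (negPf y0).
  by have : K y by []; rewrite K0.
- have : K 1 by rewrite KT.
  by move=> /(_ 1); rewrite !mulr1 => /eqP; rewrite (negPf x0).
Qed.

(** * Stable range and splitting of unimodular rows and columns *)

Section StableRange.
Variable R : nzRingType.
Hypotheses (primeR : prime_ring R) (artL : left_artinian R)
  (artR : left_artinian R^c).

(** Correcting [a] by multiples [b_i s e] with [a e = 0], [e] idempotent, never
    enlarges the left annihilator of [a], and strictly shrinks it for suitable
    [i], [s] and [e] unless [a] is invertible. *)
Lemma stable_range (n : nat) (a : R) (b : 'I_n -> R) :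
  (forall y, y * a = 0 -> (forall i, y * b i = 0) -> y = 0) ->
  exists (t : 'I_n -> R) (z : R),
    z * (a + \sum_i b i * t i) = 1 /\ (a + \sum_i b i * t i) * z = 1.
Proof.
move=> regab; pose ann (x : R) : set R := fun y => y * x = 0.
have annP x : lideal R (ann x).
  rewrite /ann; split=> [|y z yx zx|r y yx]; first by rewrite mul0r.
  - by rewrite mulrDl yx zx addr0.
  - by rewrite -mulrA yx mulr0.
have [|_ [_ [t ->] tmin]] :=
    artL (fun I => exists t : 'I_n -> R, I = ann (a + \sum_i b i * t i)).
  by exists (ann (a + \sum_i b i * 0)); split=> //; exists (fun=> 0).
exists t; move: tmin; set x := a + _ => tmin.
apply: contrapT => nunit.
have [y yx y0] : exists2 y, y * x = 0 & y != 0.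
  apply: contrapT => noy; apply/nunit/left_regular_unit => // y yx.
  by apply/eqP; apply: contrapT => /negP y0; apply: noy; exists y.
have [v xv v0] : exists2 v, x * v = 0 & v != 0.
  apply: contrapT => nov; apply: nunit.
  have [v xv|z [xz zx]] := @left_regular_unit R^c x artR; last by exists z.
  by apply/eqP; apply: contrapT => /negP v0; apply: nov; exists v.
have [e [xe e0 ee]] : exists e : R, [/\ x * e = 0, e != 0 & e * e = e].
  apply: (@lideal_idempotent R^c (fun w => (x : R) * (w : R) = 0) v) => //.
    exact: prime_ring_converse.
  split=> [|w w' xw xw'|r w xw]; first by rewrite mulr0.
  - by rewrite mulrDr xw xw' addr0.
  - by rewrite -[r * w]/((w : R) * (r : R)) mulrA xw mul0r.
have [i ybi] : exists i, y * b i != 0.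
  apply: contrapT => nobi; move/eqP: y0; apply.
  have yb i : y * b i = 0.
    by apply/eqP; apply: contrapT => /negP ybi; apply: nobi; exists i.
  apply: regab => //; move: yx; rewrite mulrDr mulr_sumr big1 ?addr0 // => i _.
  by rewrite mulrA yb mul0r.
have [s ybse] := primeR _ _ ybi e0.
pose t' j := t j + (s * e) *+ (j == i).
have xt' : a + \sum_j b j * t' j = x + b i * s * e.
  under eq_bigr do rewrite mulrDr; rewrite big_split addrA; congr (_ + _).
  rewrite (bigD1 i) //= eqxx mulr1n mulrA big1 ?addr0 // => j /negPf ->.
  by rewrite mulr0n mulr0.
have : ann (a + \sum_j b j * t' j) y.
  apply: tmin (annP _) _ _ _ yx; first by exists t'.
  rewrite xt' /ann => w wx'.
  have: w * (x + b i * s * e) * (1 - e) = 0 by rewrite wx' mul0r.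
  rewrite -mulrA mulrDl !mulrBr !mulr1 xe subr0.
  by rewrite -(mulrA _ e e) ee subrr addr0.
rewrite xt' /ann mulrDr yx add0r !mulrA => /eqP.
by rewrite (negPf ybse).
Qed.

End StableRange.

Section SplitUnimodular.
Variable R : nzRingType.
Hypotheses (primeR : prime_ring R) (artL : left_artinian R)
  (artR : left_artinian R^c).

(** With [u = (a, b)] and [x = a + b t] invertible of inverse [z], take
    [v = (z, t z)], a right inverse of [u].  A column [(p, q)] is in
    the kernel of [u] iff [x p = - b (q - t p)].  So [(p, q) |-> q - t p]
    identifies this kernel with the free module of columns of height [n]; [P]
    is the inverse of this map, and [P Q] is the projection [1 - v u] onto the
    kernel. *)
Lemma unimodular_row_compl (n : nat) (u : 'rV[R]_n.+1) :
  (forall y, y *: u = 0 -> y = 0) ->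
  exists (P : 'M[R]_(n.+1, n)) (Q : 'M[R]_(n, n.+1)) (v : 'cV[R]_n.+1),
    1%:M = P *m Q + v *m u.
Proof.
rewrite -[n.+1]/((1 + n)%N) in u * => regu.
pose a := u 0 (lshift n 0); pose b : 'rV[R]_n := rsubmx u.
have uE : u = row_mx a%:M b.
  rewrite -[LHS]hsubmxK; congr row_mx; apply/matrixP=> i j.
  by rewrite !ord1 !mxE eqxx.
have [y ya yb|t0 [z [zx _]]] := @stable_range R primeR artL artR n a (b 0).
  apply: regu; rewrite uE scale_row_mx scale_scalar_mx ya.
  suff -> : y *: b = 0 by rewrite raddf0 row_mx0.
  by apply/rowP=> i; rewrite mxE yb mxE.
pose t : 'cV[R]_n := \col_i t0 i.
have xE : (a + \sum_i b 0 i * t0 i)%:M = a%:M + b *m t :> 'M_1.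
  rewrite raddfD; congr (_ + _); apply/matrixP=> i j; rewrite !ord1 !mxE eqxx.
  by apply: eq_bigr => k _; rewrite [t k 0]mxE.
have {}zx : z%:M *m a%:M + z%:M *m b *m t = 1%:M.
  by rewrite -mulmxA -mulmxDr -xE -scalar_mxM zx.
exists (col_mx (- (z%:M *m b)) (1%:M - t *m z%:M *m b)), (row_mx (- t) 1%:M).
exists (col_mx z%:M (t *m z%:M)).
rewrite uE !mul_col_row add_block_mx (scalar_mx_block 1 n).
congr block_mx.
- by rewrite mulmxN mulNmx opprK addrC.
- by rewrite mulmx1 addNr.
- rewrite mulmxN mulmxBl mul1mx opprB addrAC -!mulmxA -mulmxDr.
  by rewrite [X in t *m X]addrC (mulmxA _ b) zx mulmx1 subrr.
- by rewrite mulmx1 subrK.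
Qed.

(** The stable range condition of the converse ring only serves to provide a
    left inverse [u] of [v].  If [1 = P Q + v' u] for this [u], then [P Q]
    fixes the columns killed by [u], in particular those of [1 - v u]; hence
    [1 = P (Q (1 - v u)) + v u]. *)
Lemma unimodular_col_compl (n : nat) (v : 'cV[R]_n.+1) :
  (forall y, v *m y%:M = 0 -> y = 0) ->
  exists (P : 'M[R]_(n.+1, n)) (Q : 'M[R]_(n, n.+1)) (u : 'rV[R]_n.+1),
    1%:M = P *m Q + v *m u.
Proof.
move=> regv.
have [u uv] : exists u : 'rV[R]_n.+1, u *m v = 1%:M.
  have [y v0y vy|t [z [_ zx]]] := stable_range R^c
      (prime_ring_converse _ primeR) artR artL n (v 0 0)
      (fun i => v (lift 0 i) 0).
    apply: regv; apply/matrixP=> i j; rewrite ord1 !mxE big_ord1 !mxE mulr1n.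
    by case: (unliftP 0 i) => [k|] ->; [exact: vy | exact: v0y].
  exists (\row_i (if unlift 0 i is Some k then (z : R) * (t k : R) else z)).
  apply/matrixP=> i j; rewrite !ord1 !mxE eqxx big_ord_recl mxE unlift_none.
  have {}zx : (z : R) * (v 0 0 + \sum_i (t i : R) * v (lift 0 i) 0) = 1 := zx.
  rewrite -[RHS]zx mulrDr mulr_sumr; congr (_ + _); apply: eq_bigr => k _.
  by rewrite mxE liftK mulrA.
have [y yu|P [Q [v' PQ]]] := unimodular_row_compl n u.
  have : (y *: u) *m v = 0 by rewrite yu mul0mx.
  by rewrite -scalemxAl uv => /matrixP/(_ 0 0); rewrite !mxE eqxx mulr1.
exists P, (Q *m (1%:M - v *m u)), u.
have -> : P *m (Q *m (1%:M - v *m u)) = 1%:M - v *m u.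
  rewrite mulmxA; have -> : P *m Q = 1%:M - v' *m u by rewrite PQ addrK.
  rewrite mulmxBl mul1mx mulmxBr mulmx1 -(mulmxA v') (mulmxA u) uv mul1mx.
  by rewrite subrr subr0.
by rewrite subrK.
Qed.

End SplitUnimodular.

(** * Compression of representations *)

Section Compression.
Variables (F : fieldType) (A : algType F) (g : nat).
Local Notation poly := (gpoly A g).
Local Notation "M %:G" := (map_mx (@gconst F A g) M)
  (at level 2, left associativity, format "M %:G").

Lemma homog_sum (w : seq 'I_g) (I : Type) (s : seq I) (p : I -> poly) :
  (forall i, homog w (p i)) -> homog w (\sum_(i <- s) p i).
Proof.
move=> homp; elim/big_rec: _ => [|i _ _ [m [k [a ->]]]].
  by exists 0%N, (fun=> 0), (fun _ _ => 0); rewrite big_ord0.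
have [m' [k' [a' ->]]] := homp i.
exists (m' + m)%N.
exists (fun j : 'I_(m' + m) =>
  match fintype.split j with inl i => k' i | inr i => k i end).
exists (fun j : 'I_(m' + m) =>
  match fintype.split j with inl i => a' i | inr i => a i end).
rewrite big_split_ord; congr (_ + _); apply: eq_bigr => j _.
  by rewrite (unsplitK (inl _ j)).
by rewrite (unsplitK (inr _ j)).
Qed.

(** The outer factors are absorbed into the coefficients [d 0] and [d 1] of each
    monomial [d 0 * x * d 1], which are distinct slots because the word has
    positive length. *)
Lemma homog_letter_mul (x : 'I_g) (p : poly) (a b : A) :
  homog [:: x] p -> homog [:: x] (gconst g a * p * gconst g b).
Proof.
move=> [m [k [d ->]]]; exists m, k.
exists (fun j i => if i is 0%N then a * d j 0%N else d j 1%N * b).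
rewrite mulr_sumr mulr_suml; apply: eq_bigr => j _.
rewrite -scalerAr -scalerAl /gmonomial !big_ord1 !rmorphM !mulrA.
by congr (_ *: (_ * _ * _ * _)).
Qed.

Lemma compress_homog (n m : nat) (r : representation A g n)
    (P : 'M[A]_(n, m)) (Q : 'M[A]_(m, n)) x i j :
  homog [:: x] ((Q%:G *m rep_A r x *m P%:G) i j).
Proof.
rewrite mxE; apply: homog_sum => k; rewrite mxE mulr_suml.
apply: homog_sum => l; rewrite !mxE; apply: homog_letter_mul.
exact: rep_AP.
Qed.

Definition compress {n m : nat} (r : representation A g n)
    (P : 'M[A]_(n, m)) (Q : 'M[A]_(m, n)) : representation A g m :=
  Representation (rep_c r *m P) (Q *m rep_b r) (compress_homog n m r P Q).

Variables (n m : nat) (r : representation A g n) (S : gseries A g).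
Variables (P : 'M[A]_(n, m)) (Q : 'M[A]_(m, n)).
Hypothesis rS : represents r S.

Lemma rep_word_cons {n'} (r' : representation A g n') x w :
  rep_word r' (x :: w) = rep_A r' x *m rep_word r' w.
Proof. exact: big_cons. Qed.

Lemma rep_word_rcons {n'} (r' : representation A g n') x w :
  rep_word r' (rcons w x) = rep_word r' w *m rep_A r' x.
Proof.
elim: w => [|y w IHw] /=.
  by rewrite rep_word_cons /rep_word big_nil mulmx1 mul1mx.
by rewrite !rep_word_cons IHw mulmxA.
Qed.

(** The hypothesis makes [P Q] the identity on every column [A^w b], because
    [u] kills it; so each factor [P Q] in [(c P) (Q A^w1 P) ... (Q b)] can be
    erased, starting from the right. *)
Lemma represents_compress_left (u : 'rV[A]_n) (v : 'cV[A]_n) :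
  1%:M = P *m Q + v *m u -> left_obstruction r u ->
  represents (compress r P Q) S.
Proof.
move=> PQ uL.
have fixb w : P%:G *m (Q%:G *m (rep_word r w *m (rep_b r)%:G)) =
              rep_word r w *m (rep_b r)%:G.
  rewrite -[RHS]mul1mx -(map_mx1 (@gconst F A g)) PQ map_mxD !map_mxM mulmxDl.
  by rewrite -!mulmxA (mulmxA u%:G) uL mulmx0 addr0.
have wordb w : rep_word (compress r P Q) w *m (Q *m rep_b r)%:G =
               Q%:G *m (rep_word r w *m (rep_b r)%:G).
  elim: w => [|x w IHw]; first by rewrite /rep_word !big_nil !mul1mx map_mxM.
  by rewrite !rep_word_cons -!mulmxA IHw fixb.
move=> w; rewrite rS /Defs.row_const /Defs.col_const /= -!mulmxA wordb.
by rewrite map_mxM -mulmxA fixb.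
Qed.

(** Here [P Q] is the identity on every row [c A^w], because such a row kills
    [v]; the factors [P Q] are erased starting from the left. *)
Lemma represents_compress_right (u : 'rV[A]_n) (v : 'cV[A]_n) :
  1%:M = P *m Q + v *m u -> right_obstruction r v ->
  represents (compress r P Q) S.
Proof.
move=> PQ vR.
have fixc w : (rep_c r)%:G *m rep_word r w *m P%:G *m Q%:G =
              (rep_c r)%:G *m rep_word r w.
  rewrite -[RHS]mulmx1 -(map_mx1 (@gconst F A g)) PQ map_mxD !map_mxM mulmxDr.
  by rewrite !mulmxA vR mul0mx addr0.
have wordc w : (rep_c r *m P)%:G *m rep_word (compress r P Q) w =
               (rep_c r)%:G *m rep_word r w *m P%:G.
  elim/last_ind: w => [|w x IHw].
    by rewrite /rep_word !big_nil !mulmx1 map_mxM.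
  by rewrite !rep_word_rcons mulmxA IHw /= !mulmxA fixc.
move=> w; rewrite rS /Defs.row_const /Defs.col_const /= wordc.
by rewrite map_mxM !mulmxA fixc.
Qed.

End Compression.

Theorem proposition4p7 (F : fieldType) (charF0 : [pchar F] =i pred0)
    (A : algType F) (simpleA : simple_ring A) (artinianA : artinian_ring A)
    (centerA : center_is_base A) (g : nat) (S : gseries A g) :
  recognizable S ->
  exists (n : nat) (r : representation A g n), represents r S /\ reduced r.
Proof.
have primeA := simple_ring_prime F A simpleA.
have artL : left_artinian A by move=> P; apply: dcc_minimal; case: artinianA.
have artR : left_artinian A^c by move=> P; apply: dcc_minimal; case: artinianA.
move=> [n [r rS]]; elim: n r rS => [|n IHn] r rS.
  (* Vectors of length 0 are killed by [1]. *)
  exists 0%N, r; split=> //; split=> u _; exists 1; rewrite ?oner_neq0 //.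
    exact: thinmx0.
  exact: flatmx0.
have [redr|/not_andP[] /existsNP[u /not_implyP[uU torsu]]] :=
    pselect (reduced r).
- by exists n.+1, r.
- have [y yu|P [Q [v PQ]]] := unimodular_row_compl A primeA artL artR n u.
    by apply/eqP; apply: contrapT => /negP y0; apply: torsu; exists y.
  by apply: (IHn (compress _ _ _ r P Q));
    apply: represents_compress_left PQ uU.
- have [y uy|P [Q [v PQ]]] := unimodular_col_compl A primeA artL artR n u.
    by apply/eqP; apply: contrapT => /negP y0; apply: torsu; exists y.
  by apply: (IHn (compress _ _ _ r P Q));
    apply: represents_compress_right PQ uU.
Qed.
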